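(* Let $F$ be a field of characteristic different from $2$ such that every element of $F$ is a square, let $n\ge 2$, and let $P$ be a standard parabolic subgroup of $\mathrm{GL}_n(F)$ with Weyl group $W$. Let $O_1,\dots,O_r$ be the orbits of $W$ acting on $\{1,\dots,n\}$. Let $C$ and $D$ be symmetric $n\times n$ matrices over $F$ and let $Y$ and $Z$ be sub-permutation $(0,1)$-matrices that are $B$-congruent to $C$ and $D$, respectively. Let $\sigma'$ and $\tau'$ be the reduced permutations associated to $Y$ and $Z$, respectively. Then the following conditions are equivalent: (a) $\sigma'$ is $W$-conjugate to $\tau'$ and $Y\{i,i\}=Z\{i,i\}$ for all $1\leq i\leq r$. (b) $C$ and $D$ are $P$-congruent. (c) $C$ and $D$ are $P$-equivalent.
   Context: $X'$ denotes the transpose of $X$. $B$ is the group of all invertible upper triangular $n\times n$ matrices over $F$. For a subgroup $H$ of $\mathrm{GL}_n(F)$, $n\times n$ matrices $X,Y$ over $F$ are $H$-equivalent if there exist $h,k\in H$ with $Y=h'Xk$, and $H$-congruent if there exists $h\in H$ with $h'Xh=Y$. A standard parabolic subgroup $P$ of $\mathrm{GL}_n(F)$ is a subgroup containing $B$. Such a $P$ is generated by $B$ and a set $J$ of transpositions of the form $(i,i+1)$, $1\le i<n$, viewed as permutation matrices (equivalently, $P$ is the group of invertible block upper triangular matrices for some fixed decomposition of $n$ into diagonal block sizes). The Weyl group $W$ of $P$ is the subgroup of $S_n$ generated by $J$. Two permutations $\alpha,\beta\in S_n$ are $W$-conjugate if $w\alpha w^{-1}=\beta$ for some $w\in W$.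 A $(0,1)$-matrix is a matrix whose entries are all $0$ or $1$. A sub-permutation is a matrix having at most one non-zero entry in every row and every column. If $Y$ is an $n\times n$ sub-permutation $(0,1)$-matrix, a $Y$-couple is a pair $(f,\sigma)$ with $\sigma\in S_n$ and $f:\{1,\dots,n\}\to\{0,1\}$ such that $Ye_i=f(i)e_{\sigma(i)}$ for $1\le i\le n$, where $e_1,\dots,e_n$ is the canonical basis of $F^n$; $S(f)$ is the set of indices where $f$ does not vanish. For $1\le i,j\le r$, $Y\{i,j\}$ is the number of indices $k$ such that $k\in S(f)$, $k\in O_i$ and $\sigma(k)\in O_j$. Reduced permutation: if $Y$ is symmetric, the $Y$-couple $(f,\sigma)$ may be chosen with $\sigma^2=1$. The reduced permutation $\sigma'$ associated to $Y$ is the permutation obtained from $\sigma$ by eliminating all transpositions $(i,j)$ in the cycle decomposition of $\sigma$ such that either $i,j$ are in the same $W$-orbit or $f(i)=0$ (and hence $f(j)=0$). Thus $\sigma'$ is the product of the disjoint transpositions $(i,j)$ such that $Y_{ij}\neq 0$ and $i,j$ lie in different $W$-orbits; it does not depend on the choice of $(f,\sigma)$. *)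

(* Defs.v *)
From HB Require Import structures.
From mathcomp Require Import all_boot all_order all_algebra all_fingroup.

Set Implicit Arguments.
Unset Strict Implicit.
Unset Printing Implicit Defensive.

Import GRing.Theory.
Local Open Scope ring_scope.

(* F is an arbitrary (usually infinite) field, for which MathComp's {'GL_n[F]}
   is not available: subgroups of GL_n(F) are predicates on 'M[F]_n. *)

Definition GL_subgroup (F : fieldType) (n : nat) (H : 'M[F]_n -> Prop) : Prop :=
  [/\ forall g, H g -> g \in unitmx,
      H 1%:M,
      forall g h, H g -> H h -> H (g *m h)
    & forall g, H g -> H (invmx g)].

Definition GL_generated (F : fieldType) (n : nat) (S : 'M[F]_n -> Prop)
    (g : 'M[F]_n) : Prop :=
  forall H : 'M[F]_n -> Prop,
    GL_subgroup H -> (forall h, S h -> H h) -> H g.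

(* is_trig_mx means lower triangular. *)
Definition borel (F : fieldType) (n : nat) (g : 'M[F]_n) : Prop :=
  g \in unitmx /\ is_trig_mx g^T.

Definition standard_parabolic (F : fieldType) (n : nat)
    (P : 'M[F]_n -> Prop) : Prop :=
  GL_subgroup P /\ (forall g, borel g -> P g).

Definition simple_transpositions (n : nat) : {set 'S_n} :=
  [set tperm ij.1 ij.2 | ij : 'I_n * 'I_n & val ij.2 == (val ij.1).+1].

Definition weyl_group (F : fieldType) (n : nat) (P : 'M[F]_n -> Prop)
    (W : {group 'S_n}) : Prop :=
  exists J : {set 'S_n},
    [/\ J \subset simple_transpositions n,
        forall g, P g <->
          GL_generated
            (fun h => borel h \/ exists2 s, s \in J & h = perm_mx s) g
      & W :=: <<J>>%g].

Definition weyl_orbits (n : nat) (W : {group 'S_n}) : {set {set 'I_n}} :=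
  [set orbit 'P W i | i : 'I_n].

(* The usual w a w^-1 composes functions from right to left; the product of
   'S_n composes from left to right, so this is (a ^ w)%g = (w^-1 * a * w)%g. *)
Definition weyl_conjugate (n : nat) (W : {group 'S_n}) (a b : 'S_n) : Prop :=
  exists2 w, w \in W & (a ^ w)%g = b.

Definition equivalent_under (F : fieldType) (n : nat) (H : 'M[F]_n -> Prop)
    (X Y : 'M[F]_n) : Prop :=
  exists h k, [/\ H h, H k & Y = h^T *m X *m k].

Definition congruent_under (F : fieldType) (n : nat) (H : 'M[F]_n -> Prop)
    (X Y : 'M[F]_n) : Prop :=
  exists2 h, H h & h^T *m X *m h = Y.

Definition zero_one_mx (F : fieldType) (n : nat) (Y : 'M[F]_n) : Prop :=
  forall i j, Y i j = 0 \/ Y i j = 1.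

Definition sub_permutation (F : fieldType) (n : nat) (Y : 'M[F]_n) : Prop :=
  (forall i j k, Y i j != 0 -> Y i k != 0 -> j = k) /\
  (forall i j k, Y i k != 0 -> Y j k != 0 -> i = j).

Definition couple (F : fieldType) (n : nat) (Y : 'M[F]_n)
    (f : 'I_n -> bool) (s : 'S_n) : Prop :=
  forall i, Y *m delta_mx i 0 = (f i)%:R *: delta_mx (s i) 0 :> 'cV[F]_n.

(* Y{i,j} for A = O_i and B = O_j, computed from a Y-couple (f, s); it depends
   only on Y, since Y determines f, and s on the support of f. *)
Definition couple_count (n : nat) (f : 'I_n -> bool) (s : 'S_n)
    (A B : {set 'I_n}) : nat :=
  #|[set k | [&& f k, k \in A & s k \in B]]|.

(* Meant for s * s = 1: the cycles of length 2 of s are then the (i, s i) with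
   i < s i, and the factors below are disjoint, so their order is irrelevant. *)
Definition reduced_permutation (n : nat) (W : {group 'S_n})
    (f : 'I_n -> bool) (s : 'S_n) : 'S_n :=
  (\prod_(i : 'I_n | [&& (i < s i)%N, f i & s i \notin orbit 'P W i])
     tperm i (s i))%g.

Lemma symmetric_couple_exists (F : fieldType) (n : nat) (Y : 'M[F]_n) :
  zero_one_mx Y -> sub_permutation Y -> Y^T = Y ->
  exists f s, couple Y f s /\ (s * s = 1)%g.
Proof.
move=> Y01 [Yrow Ycol] Ysym.
have symE i j : Y i j = Y j i by rewrite -{1}Ysym mxE.
pose g i := odflt i [pick j | Y j i != 0].
have gK : involutive g.
  move=> i; rewrite {2}/g; case: pickP => [j nz|z] /=.
    rewrite /g; case: pickP => [k nz'|/(_ i)] /=; last by rewrite symE nz.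
    by apply: (Yrow j) => //; rewrite symE.
  by rewrite /g; case: pickP => // k; rewrite z.
exists (fun i => [exists j, Y j i != 0]), (perm (inv_inj gK)); split; last first.
  by apply/permP => i; rewrite permM !permE gK.
move=> i; rewrite -colE permE /g.
apply/colP => k; rewrite !mxE eqxx andbT.
case: pickP => [j nz|z] /=.
  have -> : [exists l, Y l i != 0] by apply/existsP; exists j.
  rewrite mul1r; case: eqP => [->|/eqP kj].
    by case: (Y01 j i) => Yji; rewrite Yji // eqxx in nz *.
  apply/eqP; apply: contraNT kj => nz'; apply/eqP.
  exact: (Ycol _ _ i).
have -> : [exists l, Y l i != 0] = false.
  by apply/existsP => -[l]; rewrite z.
by rewrite mul0r; apply/eqP; move: (z k) => /negbFE.
Qed.

(* Main.v *)
(* The blocks of P are the orbits of W, which are intervals.  If D = h' C k with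
   h, k in P, then so is Z = h' Y k for other h, k; since P stabilizes the span of
   the first blocks, the corner submatrices of Y and Z with rows in the first
   blocks and columns in the first blocks have equal ranks.  These ranks count
   ones, so differences give Y{i,j} = Z{i,j} for all i, j.  Equality of all these
   numbers lets one match the points of Y with those of Z orbit by orbit by an
   element of W, compatibly with the reduced permutations.  Conversely, every
   transposition inside an orbit is a hyperbolic plane which P can diagonalize
   to the identity, so Y is P-congruent to the matrix with the same support
   function f and the reduced permutation in place of sigma; these normal forms
   of Y and Z are conjugate under W as soon as the numbers Y{i,j} and Z{i,j}
   agree. *)
Require Import Defs.
From HB Require Import structures.
From mathcomp Require Import all_boot all_order all_algebra all_fingroup.

Set Implicit Arguments.
Unset Strict Implicit.
Unset Printing Implicit Defensive.

Import GRing.Theory.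
Local Open Scope ring_scope.

(** * Parabolic Weyl groups *)

(** In a finite group, [w] is a word in the generators without inverses, so the relation can be
    followed letter by letter. *)
Lemma gen_perm_rel (T : finType) (A : {set {perm T}}) (R : rel T)
    (Rxx : reflexive R) (Rtr : transitive R)
    (RA : forall s x, s \in A -> R x (s x)) (w : {perm T}) (x : T) :
  w \in <<A>>%g -> R x (w x).
Proof.
case/gen_prodgP=> m [c cA ->].
elim: m c cA x => [|m IHm] c cA x; first by rewrite big_ord0 perm1.
rewrite big_ord_recl permM; apply: Rtr (RA _ x (cA ord0)) _.
by apply: IHm => i; apply: cA.
Qed.

Lemma simple_transpositionsP (n : nat) (s : 'S_n) :
  reflect (exists2 ij : 'I_n * 'I_n, val ij.2 = (val ij.1).+1
                                   & s = tperm ij.1 ij.2)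
          (s \in simple_transpositions n).
Proof.
apply: (iffP imsetP) => [[ij]|[ij /eqP ijS ->]].
  by rewrite inE => /eqP ijS ->; exists ij.
by exists ij; rewrite // inE.
Qed.

(** The relation [tperm x y \in <<J>>] is transitive, since conjugating (a b) by (b c) gives (a c);
    a generator moving [z] is itself [tperm z (s z)]. *)
Lemma orbit_tperm (n : nat) (J : {set 'S_n})
    (sJ : J \subset simple_transpositions n) (x y : 'I_n) :
  y \in orbit 'P <<J>>%G x -> tperm x y \in <<J>>%g.
Proof.
case/orbitP=> w wJ /= <-; rewrite apermE.
apply: (gen_perm_rel (R := fun x y => tperm x y \in <<J>>%g)) wJ => //.
- by move=> z; rewrite tperm1 group1.
- move=> b a c ab bc; case: (eqVneq a b) bc => [->//|aNb] bc.
  case: (eqVneq a c) => [->|aNc]; first by rewrite tperm1 group1.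
  have -> : tperm a c = (tperm a b ^ tperm b c)%g.
    by rewrite tpermJ tpermL tpermD // eq_sym.
  by rewrite groupJ.
move=> s z sInJ; have /simple_transpositionsP[[i j] /= _ ds] := subsetP sJ _ sInJ.
move: sInJ; rewrite ds => /mem_gen; case: tpermP => [->|->|_ _ _] //.
  by rewrite tpermC.
by rewrite tperm1 group1.
Qed.

(** This identifies the Weyl group with a full Young subgroup. Induction on the number of moved
    points: multiplying [s] by the transposition of [x] and [s x], which lies in the group, fixes
    [x] and moves no new point. *)
Lemma mem_young (n : nat) (J : {set 'S_n})
    (sJ : J \subset simple_transpositions n) (s : 'S_n) :
  (forall x, s x \in orbit 'P <<J>>%G x) -> s \in <<J>>%g.
Proof.
have [m] := ubnP #|[set x | s x != x]|; elim: m s => // m IHm s ltm orb_s.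
have [/existsP[x sxNx]|/existsPn s1] := boolP [exists x, s x != x]; last first.
  suff -> : s = 1%g by exact: group1.
  by apply/permP => x; rewrite perm1; apply/eqP; rewrite -[_ == _]negbK.
have sWx := orbit_tperm sJ (orb_s x).
rewrite -(groupMr s sWx); apply: IHm => [|y]; last first.
  rewrite permM; case: tpermP => [syx|/perm_inj->|_ _] //.
    by rewrite -(orbit_eqP (orb_s y)) syx orb_s.
  exact: orbit_refl.
rewrite ltnS in ltm; apply: leq_trans ltm; apply: proper_card.
apply/properP; split; last by exists x; rewrite !inE // permM tpermR eqxx.
apply/subsetP => y; rewrite !inE permM; apply: contraNneq => sy.
have yNx : x != y by apply: contraNneq sxNx => ->; rewrite sy.
have yNsx : s x != y by rewrite -sy (inj_eq perm_inj).
by rewrite sy tpermD.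
Qed.

(** An orbit that meets both sides of the cut just below [j] needs a generator crossing that cut,
    which can only be (j-1, j); by induction j-1 is in the orbit, hence so is [j]. *)
Lemma orbit_convex (n : nat) (J : {set 'S_n})
    (sJ : J \subset simple_transpositions n) (i j k : 'I_n) :
  (i <= j <= k)%N -> k \in orbit 'P <<J>>%G i -> j \in orbit 'P <<J>>%G i.
Proof.
case/andP=> leij lejk ik; have [m] := ubnP (j : nat).
elim: m j leij lejk => // m IHm j leij lejk ltjm.
have [->|iNj] := eqVneq j i; first exact: orbit_refl.
have ltij : (i < j)%N by rewrite ltn_neqAle leij andbT eq_sym.
have [/existsP[s /andP[sInJ /existsP[x]]]|sep] :=
  boolP [exists s in J, exists x : 'I_n, (x < j)%N != (s x < j)%N]; last first.
  case/orbitP: ik => w wJ /= wik; rewrite apermE in wik.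
  suff: (i < j)%N == (w i < j)%N by rewrite wik ltij ltnNge lejk.
  apply: (gen_perm_rel (R := fun x y : 'I_n => (x < j)%N == (y < j)%N)) wJ => //.
    by move=> a b c /eqP->.
  move=> s x sInJ; move/existsPn/(_ s): sep; rewrite sInJ /= => /existsPn/(_ x).
  by rewrite negbK.
have /simple_transpositionsP[[a b] /= eb ds] := subsetP sJ _ sInJ.
have [bj|bNj] := eqVneq b j; last first.
  have ab : (a < j)%N = (b < j)%N.
    by rewrite [in RHS]ltn_neqAle -[_ == _ :> nat]/(b == j) bNj eb.
  by rewrite ds; case: tpermP => [->|->|_ _]; rewrite ?ab eqxx.
move=> _; have aj : (a < j)%N by rewrite -bj eb.
have ai : a \in orbit 'P <<J>>%G i.
  apply: IHm; last exact: leq_trans aj _.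
    by move: ltij; rewrite -bj eb ltnS.
  exact: leq_trans (ltnW aj) lejk.
rewrite -(orbit_eqP ai) -bj; apply/orbitP; exists s; first exact: mem_gen.
by rewrite /= apermE ds tpermL.
Qed.
(** * Ranks of corner submatrices *)

(** Corner submatrices are kept at size [n], between two such projections, so that no matrix
    dimension depends on [I]. *)
Definition coord_proj (F : fieldType) (n : nat) (I : {set 'I_n}) : 'M[F]_n :=
  diag_mx (\row_i (i \in I)%:R).

Lemma tr_coord_proj (F : fieldType) (n : nat) (I : {set 'I_n}) :
  (coord_proj F I)^T = coord_proj F I.
Proof. exact: tr_diag_mx. Qed.

Lemma coord_projK (F : fieldType) (n : nat) (I : {set 'I_n}) :
  coord_proj F I *m coord_proj F I = coord_proj F I.
Proof.
rewrite mulmx_diag; congr diag_mx; apply/rowP => i; rewrite !mxE.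
by case: (i \in I); rewrite ?mulr1 ?mulr0.
Qed.

Lemma coord_proj_mulmxE (F : fieldType) (n : nat) (I I' : {set 'I_n})
    (A : 'M[F]_n) (i j : 'I_n) :
  (coord_proj F I *m A *m coord_proj F I') i j
    = if (i \in I) && (j \in I') then A i j else 0.
Proof.
rewrite mul_mx_diag mul_diag_mx !mxE.
by case: (i \in I); case: (j \in I'); rewrite ?mul1r ?mulr1 ?mul0r ?mulr0.
Qed.

(** A sum of [#|I|] matrices of rank one gives the upper bound; the lower bound follows because the
    projections for [I] and its complement add up to the identity. *)
Lemma mxrank_coord_proj (F : fieldType) (n : nat) (I : {set 'I_n}) :
  \rank (coord_proj F I) = #|I|.
Proof.
have leI (K : {set 'I_n}) : (\rank (coord_proj F K) <= #|K|)%N.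
  have -> : coord_proj F K = \sum_(i in K) delta_mx i i.
    apply/matrixP => i j; rewrite summxE !mxE.
    have [<-|iNj] := eqVneq i j; last first.
      rewrite big1 // => k _; rewrite mxE.
      by case: (eqVneq i k) => //= <-; rewrite eq_sym (negPf iNj).
    have [iK|iNK] := boolP (i \in K); last first.
      rewrite big1 // => k kK; rewrite mxE.
      by case: (eqVneq i k) iNK => //= ->; rewrite kK.
    rewrite (bigD1 i) //= mxE !eqxx big1 ?addr0 // => k /andP[_ kNi].
    by rewrite mxE eq_sym (negPf kNi).
  rewrite -sum1_card; elim/big_rec2: _ => [|i m A _ IH]; first by rewrite mxrank0.
  by apply: leq_trans (mxrank_add _ _) _; rewrite leq_add // mxrank_delta.
apply/eqP; rewrite eqn_leq leI /= -(leq_add2r (\rank (coord_proj F (~: I)))).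
apply: leq_trans (leq_add (leqnn _) (leI _)) _; rewrite cardsC card_ord.
apply: leq_trans (mxrank_add _ _); rewrite -[X in (X <= _)%N](mxrank1 F).
rewrite -raddfD /= (_ : _ + _ = const_mx 1) ?diag_const_mx ?leqnn //.
apply/rowP => i; rewrite !mxE inE; case: (i \in I); by rewrite ?addr0 ?add0r.
Qed.

(** An invertible map sending a coordinate subspace into itself maps it onto itself, by equality of
    ranks, so the inverse preserves it too. The argument is transposed to use row spaces. *)
Lemma coord_proj_inv (F : fieldType) (n : nat) (I : {set 'I_n}) (g : 'M[F]_n) :
    g \in unitmx ->
    g *m coord_proj F I = coord_proj F I *m g *m coord_proj F I ->
  invmx g *m coord_proj F I = coord_proj F I *m invmx g *m coord_proj F I.
Proof.
set E := coord_proj F I => Ug gE; pose G := g^T.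
have UG : G \in unitmx by rewrite unitmx_tr.
have EG : E *m G = E *m G *m E.
  by apply: trmx_inj; rewrite !trmx_mul trmxK tr_coord_proj mulmxA.
have rEG : \rank (E *m G) = \rank E by rewrite mxrankMfree // row_free_unit.
have sub : (E *m G <= E)%MS by rewrite EG submxMl.
have := mxrank_leqif_sup sub => -[_]; rewrite rEG eqxx => /esym/submxP[X EX].
have EGi : E *m invmx G = X *m E by rewrite {1}EX -!mulmxA mulmxV // mulmx1.
apply: trmx_inj; rewrite !trmx_mul tr_coord_proj trmx_inv -/G mulmxA EGi.
by rewrite -mulmxA coord_projK.
Qed.

(** The stabilizer of a coordinate subspace is a subgroup. It contains the Borel subgroup because
    [I] is an initial segment, and the generators from [J] because they preserve [I]. *)
Lemma parabolic_stable (F : fieldType) (n : nat) (P : 'M[F]_n -> Prop)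
    (J : {set 'S_n})
    (genP : forall g, P g <->
       GL_generated (fun h => borel h \/ exists2 s, s \in J & h = perm_mx s) g)
    (I : {set 'I_n})
    (downI : forall i j : 'I_n, (i <= j)%N -> j \in I -> i \in I)
    (JI : forall s i, s \in J -> i \in I -> s i \in I) (g : 'M[F]_n) :
  P g -> g *m coord_proj F I = coord_proj F I *m g *m coord_proj F I.
Proof.
set E := coord_proj F I => /genP Pg.
pose H (g : 'M[F]_n) := g \in unitmx /\ g *m E = E *m g *m E.
suff [_] : H g by [].
apply: Pg => [|h [[Uh trigh]|[s sJ ->]]].
- split; first by move=> h [].
  + by split; rewrite ?unitmx1 // mul1mx mulmx1 coord_projK.
  + move=> h k [Uh hE] [Uk kE]; split; first by rewrite unitmx_mul Uh.
    by rewrite -!mulmxA kE !mulmxA hE.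
  by move=> h [Uh hE]; split; rewrite ?unitmx_inv // coord_proj_inv.
- split=> //; apply/matrixP => i j; rewrite coord_proj_mulmxE mul_mx_diag !mxE.
  have [jI|jNI] := boolP (j \in I); last by rewrite mulr0 andbF.
  have [iI|iNI] := boolP (i \in I); rewrite ?mulr1 //=.
  have ltji : (j < i)%N by rewrite ltnNge; apply: contra iNI => /downI->.
  by have /is_trig_mxP/(_ _ _ ltji) := trigh; rewrite mxE.
split; first exact: unitmx_perm.
apply/matrixP => i j; rewrite coord_proj_mulmxE mul_mx_diag !mxE.
have [jI|jNI] := boolP (j \in I); last by rewrite mulr0 andbF.
have [iI|iNI] := boolP (i \in I); rewrite ?mulr1 //=.
case: eqP => // sij; case/negP: iNI.
(* The hypothesis only moves [I] forward along [s]; the inverse of [s] is reached as the power of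
   exponent [#[s] - 1]. *)
have : forall m (k : 'I_n), k \in I -> (s ^+ m)%g k \in I.
  by elim=> [|m IH] k kI; rewrite ?perm1 // expgSr permM JI // IH.
move/(_ #[s]%g.-1 j jI).
by rewrite -sij -permM -expgS prednK ?order_gt0 // expg_order perm1.
Qed.

(** Stability lets the projections pass through [h] and [k], so the new corner is the old one
    multiplied on both sides. *)
Lemma mxrank_coord_proj_le (F : fieldType) (n : nat) (I I' : {set 'I_n})
    (h Y k : 'M[F]_n) :
    h *m coord_proj F I = coord_proj F I *m h *m coord_proj F I ->
    k *m coord_proj F I' = coord_proj F I' *m k *m coord_proj F I' ->
  (\rank (coord_proj F I *m (h^T *m Y *m k) *m coord_proj F I')
     <= \rank (coord_proj F I *m Y *m coord_proj F I'))%N.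
Proof.
move=> hE kE; have hE' : coord_proj F I *m h^T
    = coord_proj F I *m h^T *m coord_proj F I.
  by apply: trmx_inj; rewrite !trmx_mul trmxK tr_coord_proj mulmxA.
have -> : coord_proj F I *m (h^T *m Y *m k) *m coord_proj F I'
  = coord_proj F I *m h^T *m (coord_proj F I *m Y *m coord_proj F I')
      *m (k *m coord_proj F I').
  by rewrite !mulmxA -hE' -!mulmxA (mulmxA (coord_proj F I') k) -kE.
by apply: leq_trans (mxrankM_maxl _ _) _; apply: mxrankM_maxr.
Qed.

Lemma coupleE (F : fieldType) (n : nat) (Y : 'M[F]_n) (f : 'I_n -> bool)
    (s : 'S_n) (Yfs : couple Y f s) (i k : 'I_n) :
  Y i k = (f k && (i == s k))%:R.
Proof.
have /colP/(_ i) := Yfs k; rewrite -colE !mxE eqxx andbT => ->.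
by rewrite -natrM mulnb.
Qed.

(** The corner is a permutation matrix times a coordinate projection. Columns are indexed by [k] and
    rows by [s k], so [I] constrains [s k]. *)
Lemma couple_rank (F : fieldType) (n : nat) (Y : 'M[F]_n) (f : 'I_n -> bool)
    (s : 'S_n) (Yfs : couple Y f s) (I I' : {set 'I_n}) :
  \rank (coord_proj F I *m Y *m coord_proj F I')
    = #|[set k | [&& f k, k \in I' & s k \in I]]|.
Proof.
set K := [set k | _].
have -> : coord_proj F I *m Y *m coord_proj F I'
    = perm_mx s^-1 *m coord_proj F K.
  apply/matrixP => i k; rewrite coord_proj_mulmxE (coupleE Yfs) mul_mx_diag !mxE.
  rewrite inE (can2_eq (permKV s) (permK s)) -natrM mulnb.
  by case: eqP => [->|_]; case: (f k); case: (s k \in I); case: (k \in I') => //=;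
    case: ifP.
rewrite -[RHS](mxrank_coord_proj F) -[LHS]mxrank_tr trmx_mul.
by rewrite mxrankMfree ?mxrank_tr // row_free_unit unitmx_tr unitmx_perm.
Qed.

(** * Counts of ones between orbits *)

Lemma couple_countDl (n : nat) (f : 'I_n -> bool) (s : 'S_n)
    (A I B : {set 'I_n}) (sAI : A \subset I) :
  couple_count f s I B = (couple_count f s A B + couple_count f s (I :\: A) B)%N.
Proof.
rewrite /couple_count -(cardsID A); congr (_ + _)%N; apply: eq_card => k.
  by rewrite !inE; case: (boolP (k \in A)) => [/(subsetP sAI)->|_];
    rewrite ?andbT ?andbF.
by rewrite !inE; case: (k \in A); case: (f k); rewrite ?andbF ?andbT //=.
Qed.

Lemma couple_countDr (n : nat) (f : 'I_n -> bool) (s : 'S_n)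
    (A B I : {set 'I_n}) (sBI : B \subset I) :
  couple_count f s A I = (couple_count f s A B + couple_count f s A (I :\: B))%N.
Proof.
rewrite /couple_count -(cardsID (s @^-1: B)).
congr (_ + _)%N; apply: eq_card => k; rewrite !inE.
  by case: (boolP (s k \in B)) => [/(subsetP sBI)->|_]; rewrite ?andbT ?andbF.
by case: (s k \in B); case: (f k); case: (k \in A); rewrite ?andbF ?andbT //=.
Qed.

(** For an orbit [C], both [down C] and [down C :\: C] are initial segments stable under [J]. Corner
    ranks agree on such segments, and differences in each variable isolate one block. *)
Lemma parabolic_equiv_count (F : fieldType) (n : nat) (P : 'M[F]_n -> Prop)
    (hP : GL_subgroup P)
    (J : {set 'S_n}) (sJ : J \subset simple_transpositions n)
    (genP : forall g, P g <->
       GL_generated (fun h => borel h \/ exists2 s, s \in J & h = perm_mx s) g)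
    (Y Z : 'M[F]_n) (YZ : equivalent_under P Y Z)
    (f g : 'I_n -> bool) (s t : 'S_n) (Yfs : couple Y f s) (Zgt : couple Z g t)
    (A B : {set 'I_n}) :
    A \in weyl_orbits <<J>>%G -> B \in weyl_orbits <<J>>%G ->
  couple_count f s A B = couple_count g t A B.
Proof.
pose down (A : {set 'I_n}) := [set i : 'I_n | [exists a in A, (i <= a)%N]].
pose cut (I : {set 'I_n}) :=
  (forall i j : 'I_n, (i <= j)%N -> j \in I -> i \in I) /\
  (forall s i, s \in J -> i \in I -> s i \in I).
have cut_le (I I' : {set 'I_n}) : cut I -> cut I' ->
    couple_count f s I I' = couple_count g t I I'.
  move=> [dI JI] [dI' JI']; case: hP => PU _ _ PV.
  case: YZ => h [k [Ph Pk eZ]].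
  (* Reversing the equivalence supplies the opposite rank inequality. *)
  have eY : Y = (invmx h)^T *m Z *m invmx k.
    rewrite eZ !mulmxA -trmx_mul mulmxV ?PU // trmx1 mul1mx -mulmxA.
    by rewrite mulmxV ?PU // mulmx1.
  apply/eqP; rewrite /couple_count -(couple_rank Yfs) -(couple_rank Zgt).
  rewrite eqn_leq {1}eY eZ !mxrank_coord_proj_le //;
    by apply: (parabolic_stable genP) => //; apply: PV.
have orbK (C : {set 'I_n}) x y : C \in weyl_orbits <<J>>%G -> x \in C ->
    (y \in C) = (y \in orbit 'P <<J>>%G x).
  by case/imsetP=> z _ -> /orbit_eqP->.
have Jorb x w : w \in J -> w x \in orbit 'P <<J>>%G x.
  by move=> wJ; apply/orbitP; exists w; rewrite ?mem_gen //= apermE.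
have down_cut (C : {set 'I_n}) : C \in weyl_orbits <<J>>%G ->
    [/\ C \subset down C, cut (down C) & cut (down C :\: C)].
  move=> oC; have dC (i j : 'I_n) : (i <= j)%N -> j \in down C -> i \in down C.
    move=> leij; rewrite !inE => /existsP[a /andP[aC lja]].
    by apply/existsP; exists a; rewrite aC (leq_trans leij).
  have JC w i : w \in J -> i \in down C -> w i \in down C.
    move=> wJ; rewrite !inE => /existsP[a /andP[aC leia]].
    apply/existsP; case: (leqP (w i) a) => [lewa|ltaw].
      by exists a; rewrite aC.
    (* Here [i <= a < w i], so convexity puts [a] in the orbit of [i]; this orbit is then [C] and
       contains [w i]. *)
    have ai : a \in orbit 'P <<J>>%G i.
      by apply: (orbit_convex sJ) (Jorb i w wJ); rewrite leia ltnW.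
    by exists (w i); rewrite leqnn andbT (orbK _ a) // (orbit_eqP ai) Jorb.
  split=> //; first by apply/subsetP => i iC; rewrite inE; apply/existsP;
    exists i; rewrite iC leqnn.
  split=> [i j leij|w i wJ]; rewrite !in_setD => /andP[jNC jdC].
    rewrite (dC _ _ leij jdC) andbT; apply: contra jNC => iC.
    move: jdC; rewrite inE => /existsP[a /andP[aC leja]].
    rewrite (orbK _ i) //; apply: (orbit_convex sJ (k := a)).
      by rewrite leij.
    by rewrite -(orbK C).
  rewrite JC // andbT; apply: contra jNC => wiC.
  by rewrite (orbK _ (w i)) // orbit_sym Jorb.
move=> oA oB; have [sA cA cA'] := down_cut A oA.
have [sB cB cB'] := down_cut B oB.
have half (I : {set 'I_n}) : cut I ->
    couple_count f s A I = couple_count g t A I.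
  move=> cI; have := cut_le _ _ cA cI.
  by rewrite !(couple_countDl _ _ I sA) (cut_le _ _ cA' cI) => /addIn.
by have := half _ cB; rewrite !(couple_countDr _ _ A sB) (half _ cB') => /addIn.
Qed.
(** * Reduced permutations *)

Lemma reduced_permutationE (n : nat) (W : {group 'S_n}) (f : 'I_n -> bool)
    (s : 'S_n) (s2 : (s * s)%g = 1%g) (fs : forall k, f (s k) = f k) (x : 'I_n) :
  reduced_permutation W f s x
    = if f x && (s x \notin orbit 'P W x) then s x else x.
Proof.
have sK k : s (s k) = k by rewrite -permM s2 perm1.
(* Requiring [i < s i] keeps one index of each 2-cycle, so the factors are disjoint and at most one
   moves [y]. *)
have prodE (r : seq 'I_n) : uniq r -> (forall i, i \in r -> (i < s i)%N) ->
    forall y, (\prod_(i <- r) tperm i (s i))%g y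
      = if (y \in r) || (s y \in r) then s y else y.
  elim: r => [|i r IHr] /=; first by move=> _ _ y; rewrite big_nil perm1.
  case/andP=> iNr Ur lt_s y; have lti := lt_s i (mem_head _ _).
  have lt_r j : j \in r -> (j < s j)%N by move=> jr; rewrite lt_s // inE jr orbT.
  have siNr : s i \notin r.
    by apply/negP => /lt_r; rewrite sK ltnNge ltnW.
  have sNi : s i != i by apply: contraTneq lti => ->; rewrite ltnn.
  rewrite big_cons permM !inE; case: tpermP => [->|->|/eqP yNi /eqP yNsi].
  - by rewrite IHr // sK (negPf siNr) (negPf iNr) eqxx.
  - by rewrite IHr // sK (negPf siNr) (negPf iNr) eqxx orbT.
  have syNi : s y != i by apply: contraNneq yNsi => <-; rewrite sK.
  by rewrite IHr // (negPf yNi) (negPf syNi).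
rewrite /reduced_permutation -big_filter prodE; first last.
- by move=> i; rewrite mem_filter => /andP[/and3P[]].
- by rewrite filter_uniq // index_enum_uniq.
rewrite !mem_filter !mem_index_enum !andbT sK fs [x \in orbit _ _ _]orbit_sym.
case: (f x) => //=; rewrite ?andbF //=.
have [|sxNx] := boolP (s x \in orbit 'P W x); first by rewrite !andbF.
rewrite !andbT -neq_ltn; case: eqP => // sx.
by rewrite -[s x](val_inj sx) orbit_refl in sxNx.
Qed.

(** Equal multiplicities make the two lists of labels permutations of each other. *)
Lemma exists_label_perm (n : nat) (L : eqType) (a b : 'I_n -> L) :
    (forall l, #|[set k | a k == l]| = #|[set k | b k == l]|) ->
  exists w : 'S_n, forall k, b (w k) = a k.
Proof.
move=> eq_ab; have countE (c : 'I_n -> L) l :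
    count_mem l [seq c k | k <- enum 'I_n] = #|[set k | c k == l]|.
  by rewrite count_map cardE enumT /enum_mem size_filter -enumT;
    apply: eq_count => k; rewrite /= inE.
have /tuple_permP[w ew] : perm_eq [tuple a k | k < n] [tuple b k | k < n].
  by apply/allP => l _ /=; rewrite !countE eq_ab.
exists w => k; have := congr1 (fun r => nth (a k) r k) ew.
by rewrite -!tnth_nth !tnth_mktuple.
Qed.

(** A matching of the orbit labels of points and of their images exists by counting; it is then
    corrected to intertwine [s] and [t]. Preserving orbits places it in the Weyl group. *)
Lemma exists_weyl_matching (n : nat) (J : {set 'S_n})
    (sJ : J \subset simple_transpositions n) (f g : 'I_n -> bool) (s t : 'S_n)
    (s2 : (s * s)%g = 1%g) (t2 : (t * t)%g = 1%g)
    (fs : forall k, s k != k -> f k) (gt : forall k, t k != k -> g k)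
    (os : forall k, s k \in orbit 'P <<J>>%G k -> s k = k)
    (ot : forall k, t k \in orbit 'P <<J>>%G k -> t k = k)
    (eq_count : forall A B,
       A \in weyl_orbits <<J>>%G -> B \in weyl_orbits <<J>>%G ->
       couple_count f s A B = couple_count g t A B) :
  exists2 w, w \in <<J>>%g & forall k, g (w k) = f k /\ w (s k) = t (w k).
Proof.
pose o := orbit 'P <<J>>%G.
have sK k : s (s k) = k by rewrite -permM s2 perm1.
have tK k : t (t k) = k by rewrite -permM t2 perm1.
have oE A k : (o k == A) = (A \in weyl_orbits <<J>>%G) && (k \in A).
  apply/eqP/andP => [<-|[/imsetP[j _ ->] /orbit_eqP//]].
  by rewrite orbit_refl imset_f.
pose lab (f : 'I_n -> bool) (s : 'S_n) k := (o k, if f k then Some (o (s k)) else None).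
have labS f' s' A B : #|[set k | lab f' s' k == (A, Some B)]|
    = if (A \in weyl_orbits <<J>>%G) && (B \in weyl_orbits <<J>>%G)
      then couple_count f' s' A B else 0%N.
  rewrite -[LHS]/(#|_|) /couple_count; case: ifP => oAB.
    apply: eq_card => k; rewrite !inE xpair_eqE /=.
    case/andP: oAB => oA oB; rewrite oE oA; case: (f' k) => /=; last by rewrite andbF.
    by rewrite -[Some _ == _]/(o (s' k) == B) oE oB.
  apply: eq_card0 => k; rewrite !inE xpair_eqE oE; case: (f' k); rewrite ?andbF //.
  rewrite -[Some _ == _]/(o (s' k) == B) oE.
  by case: (A \in _) oAB => //= ->; rewrite andbF.
(* The points off the support are counted by complement within each orbit, as the hypothesis only
   counts points of the support. *)
have labN f' s' A : #|[set k | o k == A]| =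
    (#|[set k | lab f' s' k == (A, None)]|
      + \sum_(B : {set 'I_n}) #|[set k | lab f' s' k == (A, Some B)]|)%N.
  rewrite -(cardsID [set k | f' k]) addnC; congr (_ + _)%N.
    by apply: eq_card => k; rewrite !inE xpair_eqE; case: (f' k);
      rewrite ?andbF ?andbT.
  rewrite -sum1_card (partition_big (fun k => o (s' k)) xpredT) //=.
  apply: eq_bigr => B _; rewrite -sum1_card; apply: eq_bigl => k.
  by rewrite !inE xpair_eqE; case: (f' k); rewrite ?andbF ?andbT.
have eqS A B : #|[set k | lab f s k == (A, Some B)]|
             = #|[set k | lab g t k == (A, Some B)]|.
  by rewrite !labS; case: ifP => // /andP[oA oB]; rewrite eq_count.
have [|w0 labw] := @exists_label_perm n _ (lab f s) (lab g t).
  case=> A [B|]; first exact: eqS.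
  apply/eqP; have := labN f s A; rewrite (labN g t) => /eqP.
  by rewrite (eq_bigr _ (fun B _ => eqS A B)) eqn_add2r eq_sym.
have ow k : o (w0 k) = o k by case: (labw k).
have gw k : g (w0 k) = f k by case: (labw k) => _; case: (f k); case: (g _).
have otw k : f k -> o (t (w0 k)) = o (s k).
  by move=> fk; case: (labw k) => _; rewrite gw fk => -[].
have osN k : o (s k) = o k -> s k = k by move=> e; apply: os; apply/orbit_eqP.
have otN k : o (t k) = o k -> t k = k by move=> e; apply: ot; apply/orbit_eqP.
(* Off the support both involutions fix the point, so the label determines the orbit of the image
   there too. *)
have otw' k : o (t (w0 k)) = o (s k).
  have [/otw//|fNk] := boolP (f k).
  have /eqP-> : s k == k by apply: contraNT fNk => /fs.
  suff /eqP-> : t (w0 k) == w0 k by [].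
  by apply: contraNT fNk => /gt; rewrite gw.
(* s pairs the points of distinct orbits; only the member whose orbit comes
   first in an arbitrary order is matched freely, the other one follows. *)
pose rk k := enum_rank (o k).
have rkE k l : o k = o l -> rk k = rk l by rewrite /rk => ->.
pose first k := (rk k <= rk (s k))%N.
pose w k := if first k then w0 k else t (w0 (s k)).
have owk k : o (w k) = o k by rewrite /w; case: ifP => _; rewrite ?otw' ?sK.
have rk_eq k : first k -> first (s k) -> s k = k.
  rewrite /first sK => h1 h2; apply: osN; apply: enum_rank_inj.
  by apply/val_inj/eqP; rewrite eqn_leq h2.
have wst k : w (s k) = t (w k).
  rewrite /w sK; case: ifP => fsk; case: ifP => fk; rewrite ?tK //.
    have sk := rk_eq _ fk fsk; rewrite sk.
    by apply/esym/otN; rewrite otw' sk ow.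
  by move: fsk fk; rewrite /first sK => /negbT; rewrite -ltnNge => /ltnW->.
(* Whether [k] is the first of its pair can be read off [w k], so the two branches of [w] have
   disjoint images. *)
have firstE k : first k = (rk (w k) <= rk (t (w k)))%N.
  by rewrite -wst /first !(rkE _ _ (owk _)).
have w_inj : injective w.
  move=> k l ekl; have efl : first k = first l by rewrite !firstE ekl.
  move: ekl; rewrite /w efl; case: ifP => _; first exact: perm_inj.
  by move/perm_inj/perm_inj/perm_inj.
have fss k : f (s k) = f k.
  have [->//|sk] := eqVneq (s k) k; rewrite (fs k sk) fs // sK eq_sym //.
have gtt k : g (t k) = g k.
  have [->//|tk] := eqVneq (t k) k; rewrite (gt k tk) gt // tK eq_sym //.
exists (perm w_inj) => [|k]; last first.
  rewrite !permE; split=> //; rewrite /w; case: ifP => _ //.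
  by rewrite gtt gw fss.
by apply: mem_young => // k; rewrite permE; apply/orbit_eqP; apply: owk.
Qed.
(** * Diagonalization inside the orbits *)

(* The column j is a j e_j + b j e_(rho j); for rho an involution these matrices
   form an algebra. *)
Definition pair_mx (F : fieldType) (n : nat) (rho : 'I_n -> 'I_n)
    (a b : 'I_n -> F) : 'M[F]_n :=
  \matrix_(i, j) (a j *+ (i == j) + b j *+ (i == rho j)).

Lemma mul_pair_mxE (F : fieldType) (n : nat) (rho : 'I_n -> 'I_n)
    (a b : 'I_n -> F) (A : 'M[F]_n) (i j : 'I_n) :
  (A *m pair_mx rho a b) i j = A i j * a j + A i (rho j) * b j.
Proof.
rewrite mxE; under eq_bigr do rewrite mxE mulrDr !mulrnAr.
have sum1 c k0 : \sum_k (A i k * c) *+ (k == k0) = A i k0 * c.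
  rewrite (bigD1 k0) //= eqxx big1 ?addr0 // => k /negPf->.
  by rewrite mulr0n.
by rewrite big_split /= !sum1.
Qed.

Lemma mul_tr_pair_mxE (F : fieldType) (n : nat) (rho : 'I_n -> 'I_n)
    (a b : 'I_n -> F) (A : 'M[F]_n) (i j : 'I_n) :
  ((pair_mx rho a b)^T *m A) i j = A i j * a i + A (rho i) j * b i.
Proof.
by rewrite -[A]trmxK -trmx_mul [LHS]mxE mul_pair_mxE !mxE.
Qed.

Lemma mul_pair_mx (F : fieldType) (n : nat) (rho : 'I_n -> 'I_n)
    (rhoK : involutive rho) (a b c d : 'I_n -> F) :
  pair_mx rho a b *m pair_mx rho c d
    = pair_mx rho (fun j => a j * c j + b (rho j) * d j)
                  (fun j => b j * c j + a (rho j) * d j).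
Proof.
apply/matrixP => i j; rewrite mul_pair_mxE !mxE rhoK.
rewrite !mulrDl !mulrnDl !mulrnAl -!addrA; congr (_ + _).
by rewrite addrCA addrC -addrA addrCA; congr (_ + _); rewrite addrC.
Qed.

(** The coefficient [b j] sits in row [rho j] and column [j], below the diagonal only when
    [j < rho j]. At fixed points it vanishes as well, so the diagonal is exactly [a]. *)
Lemma borel_pair_mx (F : fieldType) (n : nat) (rho : 'I_n -> 'I_n)
    (a b : 'I_n -> F) :
    (forall j, a j != 0) -> (forall j : 'I_n, (j <= rho j)%N -> b j = 0) ->
  borel (pair_mx rho a b).
Proof.
move=> a0 b0; have trig : is_trig_mx (pair_mx rho a b)^T.
  apply/is_trig_mxP => i j ltij; rewrite !mxE.
  have /negPf-> : j != i by rewrite -(inj_eq val_inj) /= gtn_eqF.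
  have [eji|_] := eqVneq j (rho i); rewrite ?addr0 ?add0r //=.
  by rewrite b0 ?mul0rn ?addr0 // -eji ltnW.
split=> //; rewrite unitmxE -det_tr det_trig // unitfE prodf_seq_neq0.
apply/allP => i _ /=; rewrite !mxE eqxx.
have [ei|_] := eqVneq i (rho i); last by rewrite !mulrb addr0.
have -> : b i = 0 by rewrite b0 // -ei.
by rewrite mul0rn mulrb addr0.
Qed.

Lemma perm_mx_parabolic (F : fieldType) (n : nat) (P : 'M[F]_n -> Prop)
    (hP : GL_subgroup P) (J : {set 'S_n})
    (genP : forall g, P g <->
       GL_generated (fun h => borel h \/ exists2 s, s \in J & h = perm_mx s) g)
    (w : 'S_n) :
  w \in <<J>>%g -> P (perm_mx w).
Proof.
case: hP => _ P1 PM _; case/gen_prodgP=> m [c cJ ->].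
elim: m c cJ => [|m IHm] c cJ; first by rewrite big_ord0 perm_mx1.
rewrite big_ord_recl perm_mxM; apply: PM; last by apply: IHm => i; apply: cJ.
by apply/genP => H _ sH; apply: sH; right; exists (c ord0).
Qed.

(* For each transposition (i, s i) inside an orbit, h replaces the hyperbolic
   pair e_i, e_(s i) by p (e_i + e_(s i)), q (e_i - e_(s i)), which is
   orthonormal because 2 p^2 = 1 and - 2 q^2 = 1.  In these coordinates
   [[p, q], [p, - q]] = [[1, 0], [1, 1]] [[p, q], [0, - 2 q]], and the lower
   triangular factor is a conjugate of an upper triangular one under W. *)
Lemma congruent_reduced (F : fieldType) (n : nat) (P : 'M[F]_n -> Prop)
    (char_not_2 : 2%N \notin [pchar F])
    (squares : forall x : F, exists y : F, y ^+ 2 = x)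
    (hP : standard_parabolic P)
    (J : {set 'S_n}) (sJ : J \subset simple_transpositions n)
    (genP : forall g, P g <->
       GL_generated (fun h => borel h \/ exists2 s, s \in J & h = perm_mx s) g)
    (Y : 'M[F]_n) (f : 'I_n -> bool) (s : 'S_n) (Yfs : couple Y f s)
    (s2 : (s * s)%g = 1%g) (fs : forall k, f (s k) = f k) :
  congruent_under P Y
    (\matrix_(i, k) (f k && (i == reduced_permutation <<J>>%G f s k))%:R).
Proof.
have sK k : s (s k) = k by rewrite -permM s2 perm1.
(* [rho] retains exactly the transpositions of [s] that reduction removes and on which [f] is
   nonzero. *)
pose intra k := f k && (s k \in orbit 'P <<J>>%G k).
pose rho k := if intra k then s k else k.
have intraS k : intra (s k) = intra k by rewrite /intra fs sK orbit_sym.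
have rhoK : involutive rho.
  by move=> k; case ik: (intra k); rewrite /rho ik ?intraS ik ?sK.
have rhoP : perm (inv_inj rhoK) \in <<J>>%g.
  apply: mem_young => // k; rewrite permE /rho /intra.
  by case: ifP => [/andP[]//|_]; apply: orbit_refl.
have two0 : 2%:R != 0 :> F by move: char_not_2; rewrite inE.
have half2 : 2%:R^-1 + 2%:R^-1 = 1 :> F.
  by rewrite -[2%:R^-1]mul1r -mulrDl -mulr2n divff.
have [p p2] := squares 2%:R^-1; have [q q2] := squares (- 2%:R^-1).
have p0 : p != 0.
  by apply: contraNneq (invr_neq0 two0) => p0; rewrite -p2 p0 expr0n.
have q0 : q != 0.
  have: - (2%:R^-1 : F) != 0 by rewrite oppr_eq0 invr_eq0.
  by apply: contraNneq => q0; rewrite -q2 q0 expr0n.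
(* [L] is unipotent upper triangular and [R] swaps each pair, so [R *m L *m R] is the lower
   triangular factor; [U] is the upper one. *)
pose b (k : 'I_n) : F := (rho k < k)%:R.
pose u (k : 'I_n) := if (k < rho k)%N then p else if (rho k < k)%N then - (q + q) else 1.
pose v (k : 'I_n) := if (rho k < k)%N then q else 0.
pose L := pair_mx rho (fun _ => 1) b; pose U := pair_mx rho u v.
pose R : 'M[F]_n := perm_mx (perm (inv_inj rhoK)).
have ER : R = pair_mx rho (fun _ => 0) (fun _ => 1).
  apply/matrixP => i j; rewrite !mxE permE mul0rn add0r.
  by rewrite (can2_eq rhoK rhoK).
have BL : borel L.
  apply: borel_pair_mx => [j|j le_j]; first exact: oner_neq0.
  by rewrite /b ltnNge le_j.
have BU : borel U.
  apply: borel_pair_mx => j; rewrite /u /v; last by rewrite leqNgt => /negPf->.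
  case: ifP => // _; case: ifP => // _; rewrite ?oner_neq0 //.
  by rewrite -mulr2n -mulr_natl oppr_eq0 mulf_neq0.
case: hP => hP' PB; have [_ _ PM _] := hP'.
have PR : P R by apply: perm_mx_parabolic rhoP.
exists (R *m L *m R *m U).
  by apply: (PM); [apply: (PM); [apply: (PM)|]|];
    rewrite -?/R //; apply: PB.
rewrite ER !mul_pair_mx //=; set al := (fun j => _ * u j + _).
set be := (fun j => _ * u j + _).
(* The coefficients of the product, in three cases: fixed points, the smaller index of a pair
   (column p, p), the larger one (column q, -q). *)
have fixE k : rho k = k -> al k = 1 /\ be k = 0.
  move=> rk; rewrite /al /be /u /v /b !rhoK rk !ltnn.
  by rewrite !(mul0r, mulr0, mul1r, mulr1, add0r, addr0).
have ltE (k : 'I_n) : (k < rho k)%N -> al k = p /\ be k = p.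
  move=> lt; rewrite /al /be /u /v /b !rhoK lt (ltnNge (rho k)) (ltnW lt) /=.
  by rewrite !(mul0r, mulr0, mul1r, mulr1, add0r, addr0).
have gtE (k : 'I_n) : (rho k < k)%N -> al k = - q /\ be k = q.
  move=> lt; rewrite /al /be /u /v /b !rhoK lt (ltnNge k) (ltnW lt) /=.
  rewrite !(mul0r, mulr0, mul1r, mulr1, add0r, addr0).
  by rewrite opprD -addrA addNr addr0.
have pp : p * p + p * p = 1 by rewrite -expr2 p2 half2.
have qq : q * q + q * q = - 1.
  by rewrite -expr2 q2 -opprD half2.
apply/matrixP => i j; rewrite mul_pair_mxE !mul_tr_pair_mxE !(coupleE Yfs) mxE.
rewrite reduced_permutationE //.
have -> : f (rho j) = f j by rewrite /rho; case: ifP => // _; rewrite fs.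
have [fj|_] := boolP (f j); last by rewrite !andFb !(mul0r, addr0).
rewrite !(can2_eq rhoK rhoK).
(* If [s j] lies in another orbit, the base change fixes both basis vectors and the entry is
   unchanged. *)
have [ij|] := boolP (s j \in orbit 'P <<J>>%G j); last first.
  move=> /negPf ij; have rj : rho j = j by rewrite /rho /intra ij andbF.
  have rsj : rho (s j) = s j.
    by rewrite /rho intraS /intra ij andbF.
  have [aj bj] := fixE _ rj; rewrite aj bj mulr0 addr0 mulr1 rsj /=.
  case: eqP => [->|_]; last by rewrite !mul0r addr0.
  by have [-> ->] := fixE _ rsj; rewrite mulr1 mulr0 addr0.
have inj : intra j by rewrite /intra fj.
have rj : rho j = s j by rewrite /rho inj.
have rsj : rho (s j) = j by rewrite -rj rhoK.
rewrite rj sK rsj rj /=.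
(* On a hyperbolic pair the diagonal entries become 2 p^2 = 1 and - 2 q^2 = 1, while the mixed terms
   p q cancel. *)
case: (ltngtP j (s j)) => [ltj|gtj|/val_inj ej].
- have [aj bj] : al j = p /\ be j = p by apply: ltE; rewrite rj.
  have [asj bsj] : al (s j) = - q /\ be (s j) = q by apply: gtE; rewrite rsj.
  have sj : (j == s j) = false by apply/eqP => e; rewrite -e ltnn in ltj.
  have [->|iNj] := eqVneq i j.
    by rewrite sj aj bj !(mul0r, mul1r, add0r, addr0) pp.
  have [->|iNsj] := eqVneq i (s j).
    by rewrite aj bj asj bsj !(mul0r, mul1r, add0r, addr0) -mulrDl addNr mul0r.
  by rewrite !(mul0r, addr0).
- have [aj bj] : al j = - q /\ be j = q by apply: gtE; rewrite rj.
  have [asj bsj] : al (s j) = p /\ be (s j) = p by apply: ltE; rewrite rsj.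
  have sj : (j == s j) = false by apply/eqP => e; rewrite -e ltnn in gtj.
  have [->|iNj] := eqVneq i j.
    rewrite sj aj bj !(mul0r, mul1r, add0r, addr0) mulrN mulNr -opprD qq.
    by rewrite opprK.
  have [->|iNsj] := eqVneq i (s j).
    by rewrite aj bj asj bsj !(mul0r, mul1r, add0r, addr0) mulrN addNr.
  by rewrite !(mul0r, addr0).
have [aj bj] : al j = 1 /\ be j = 0 by apply: fixE; rewrite rj -ej.
rewrite -ej bj mulr0 addr0 aj mulr1.
case: eqP => [->|_]; last by rewrite !mul0r addr0.
by rewrite aj bj mulr0 mulr1 addr0.
Qed.

(** * Symmetric couples, and the formal properties of congruence and equivalence *)

(** Symmetry equates the entries at (k, s k) and (s k, k), which are [f (s k)] and [f k] read in the
    field. *)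
Lemma couple_support_stable (F : fieldType) (n : nat) (Y : 'M[F]_n) (f : 'I_n -> bool)
    (s : 'S_n) (Yfs : couple Y f s) (s2 : (s * s)%g = 1%g) :
  Y^T = Y -> forall k, f (s k) = f k.
Proof.
move=> Ysym k; have /matrixP/(_ k (s k)) := Ysym.
rewrite mxE !(coupleE Yfs) -permM s2 perm1 !eqxx !andbT => e.
by case: (f k) (f (s k)) e => -[] // /eqP; rewrite ?oner_eq0 // eq_sym oner_eq0.
Qed.

Lemma congruent_invmx (F : fieldType) (n : nat) (X Y h : 'M[F]_n) :
  h \in unitmx -> h^T *m X *m h = Y -> (invmx h)^T *m Y *m invmx h = X.
Proof.
move=> Uh <-; rewrite !mulmxA -trmx_mul mulmxV // trmx1 mul1mx -mulmxA.
by rewrite mulmxV // mulmx1.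
Qed.

Lemma congruent_under_trans (F : fieldType) (n : nat) (P : 'M[F]_n -> Prop)
    (hP : GL_subgroup P) (X Y Z : 'M[F]_n) :
  congruent_under P X Y -> congruent_under P Y Z -> congruent_under P X Z.
Proof.
case: hP => _ _ PM _ [h Ph <-] [k Pk <-]; exists (h *m k); first exact: PM.
by rewrite trmx_mul !mulmxA.
Qed.

Lemma congruent_under_sym (F : fieldType) (n : nat) (P : 'M[F]_n -> Prop)
    (hP : GL_subgroup P) (X Y : 'M[F]_n) :
  congruent_under P X Y -> congruent_under P Y X.
Proof.
case: hP => PU _ _ PV [h Ph hXY]; exists (invmx h); first exact: PV.
by apply: congruent_invmx hXY; apply: PU.
Qed.

Lemma congruent_equivalent_under (F : fieldType) (n : nat) (P : 'M[F]_n -> Prop)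
    (X Y : 'M[F]_n) :
  congruent_under P X Y -> equivalent_under P X Y.
Proof. by case=> h Ph <-; exists h, h. Qed.

Lemma equivalent_under_trans (F : fieldType) (n : nat) (P : 'M[F]_n -> Prop)
    (hP : GL_subgroup P) (X Y Z : 'M[F]_n) :
  equivalent_under P X Y -> equivalent_under P Y Z -> equivalent_under P X Z.
Proof.
case: hP => _ _ PM _ [h [k [Ph Pk ->]]] [h' [k' [Ph' Pk' ->]]].
exists (h *m h'), (k *m k'); split; [exact: PM | exact: PM |].
by rewrite trmx_mul !mulmxA.
Qed.

Theorem theorem5p2 (F : fieldType) (n : nat)
  (char_not_2 : 2%N \notin [pchar F])
  (squares : forall x : F, exists y : F, y ^+ 2 = x)
  (n_ge2 : (2 <= n)%N)
  (P : 'M[F]_n -> Prop) (hP : standard_parabolic P)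
  (W : {group 'S_n}) (hW : weyl_group P W)
  (C D Y Z : 'M[F]_n)
  (C_sym : C^T = C) (D_sym : D^T = D)
  (Y_sub : sub_permutation Y) (Y_01 : zero_one_mx Y)
  (Z_sub : sub_permutation Z) (Z_01 : zero_one_mx Z)
  (YC : congruent_under (@borel F n) Y C)
  (ZD : congruent_under (@borel F n) Z D)
  (f g : 'I_n -> bool) (sigma tau : 'S_n)
  (Y_couple : couple Y f sigma) (sigma_inv : (sigma * sigma)%g = 1%g)
  (Z_couple : couple Z g tau) (tau_inv : (tau * tau)%g = 1%g) :
  let a :=
    weyl_conjugate W (reduced_permutation W f sigma)
                     (reduced_permutation W g tau) /\
    (forall O : {set 'I_n}, O \in weyl_orbits W ->
       couple_count f sigma O O = couple_count g tau O O) in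
  let b := congruent_under P C D in
  let c := equivalent_under P C D in
  (a <-> b) /\ (b <-> c).
Proof.
case: hP => sP PB.
case: hW => J [sJ genP WJ]; have {WJ} WJ : W = <<J>>%G by apply: val_inj.
subst W.
have YCP : congruent_under P Y C by case: YC => h /PB Ph hYC; exists h.
have ZDP : congruent_under P Z D by case: ZD => h /PB Ph hZD; exists h.
have symB (X X' : 'M[F]_n) : congruent_under (@borel F n) X X' -> X'^T = X' ->
    X^T = X.
  case=> h [Uh _] hX sX'; rewrite -(congruent_invmx Uh hX).
  by rewrite !trmx_mul trmxK sX' mulmxA.
have fs := couple_support_stable Y_couple sigma_inv (symB _ _ YC C_sym).
have gt := couple_support_stable Z_couple tau_inv (symB _ _ ZD D_sym).
pose s := reduced_permutation <<J>>%G f sigma.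
pose t := reduced_permutation <<J>>%G g tau.
pose o := orbit 'P <<J>>%G.
(* Reduction keeps all block counts: a point of the support whose image changes keeps that image
   within the same orbit. *)
have redP (f' : 'I_n -> bool) s' (r := reduced_permutation <<J>>%G f' s') :
    (s' * s' = 1)%g -> (forall k, f' (s' k) = f' k) ->
  [/\ (r * r = 1)%g, forall k, r k != k -> f' k,
      forall k, r k \in o k -> r k = k
    & forall A B, A \in weyl_orbits <<J>>%G -> B \in weyl_orbits <<J>>%G ->
        couple_count f' s' A B = couple_count f' r A B].
  move=> s'2 f's'; have s'K k : s' (s' k) = k by rewrite -permM s'2 perm1.
  have rE := reduced_permutationE <<J>>%G s'2 f's'.
  split=> [|k|k|A B oA oB].
  - apply/permP => k; rewrite permM perm1 /r (rE k).
    case: ifP => fk; last by rewrite rE fk.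
    by rewrite rE s'K f's' orbit_sym fk.
  - by rewrite /r rE; case: (f' k); rewrite // eqxx.
  - by rewrite /r rE; case: ifP => // /andP[_ /negPf->].
  apply: eq_card => k; rewrite !inE /r rE; case: (f' k) => //=.
  case: (boolP (s' k \in orbit 'P <<J>>%G k)) => //= sk; congr (_ && _).
  case/imsetP: oB => x _ ->; rewrite orbit_sym [RHS]orbit_sym.
  by rewrite (orbit_eqP sk).
have [s2 sf os Ns] := redP _ _ sigma_inv fs.
have [t2 tg ot Nt] := redP _ _ tau_inv gt.
rewrite -/s -/t in s2 sf os Ns t2 tg ot Nt *.
set a := _ /\ _; cbv zeta.
have ab : a -> congruent_under P C D.
  case=> [[w wW ewt] eqO].
  have wt k : w (s k) = t (w k) by rewrite -ewt !permM permK.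
  have owE A k : A \in weyl_orbits <<J>>%G -> (w k \in A) = (k \in A).
    case/imsetP=> x _ ->; rewrite orbit_sym [RHS]orbit_sym.
    suff /orbit_eqP-> : w k \in orbit 'P <<J>>%G k by [].
    by apply/orbitP; exists w.
  have eq_count A B : A \in weyl_orbits <<J>>%G -> B \in weyl_orbits <<J>>%G ->
      couple_count f s A B = couple_count g t A B.
    move=> oA oB; have [<-|AB] := eqVneq A B; first by rewrite -Ns // -Nt // eqO.
    (* Only diagonal counts are assumed. For distinct orbits every counted point is moved, hence in
       the support, and [w] carries one set of such points onto the other. *)
    have offdiag (f' : 'I_n -> bool) (r : 'S_n) : (forall k, r k != k -> f' k) ->
        couple_count f' r A B = #|[set k | (k \in A) && (r k \in B)]|.
      move=> rf; apply: eq_card => k; rewrite !inE; case: (boolP (f' k)) => //= fk.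
      have /eqP-> : r k == k by apply: contraNT fk => /rf.
      apply/esym/negP => /andP[kA kB]; case/eqP: AB.
      case/imsetP: oA kA => x _ -> /orbit_eqP<-.
      by case/imsetP: oB kB => y _ -> /orbit_eqP<-.
    rewrite !offdiag // -(card_imset _ (@perm_inj _ w)); apply: eq_card => k.
    rewrite -[k](permKV w); set l := (w^-1)%g k.
    by rewrite (mem_imset _ _ perm_inj) !inE -wt !owE.
  (* The given [w] may fail to carry [f] to [g] on fixed points, so a new element [v] respecting the
     supports is taken. *)
  have [v vW vP] := exists_weyl_matching sJ s2 t2 sf tg os ot eq_count.
  have YY := congruent_reduced char_not_2 squares (conj sP PB) sJ genP
    Y_couple sigma_inv fs.
  have ZZ := congruent_reduced char_not_2 squares (conj sP PB) sJ genP
    Z_couple tau_inv gt.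
  (* The chain runs from [C] through [Y], its reduced form, the reduced form of [Z], and [Z] to [D];
     [perm_mx v] provides the middle link. *)
  apply: (congruent_under_trans sP) (congruent_under_sym sP YCP) _.
  apply: (congruent_under_trans sP) YY _; apply: (congruent_under_trans sP) _ ZDP.
  apply: (congruent_under_trans sP) _ (congruent_under_sym sP ZZ).
  exists (perm_mx v); first exact: (perm_mx_parabolic sP genP).
  rewrite tr_perm_mx -row_permE -{2}[v]invgK -col_permE -/s -/t.
  apply/matrixP => i k; rewrite !mxE.
  have [gE tE] := vP ((v^-1)%g k); rewrite permKV in gE tE.
  by rewrite -gE -tE (can2_eq (permKV v) (permK v)).
have bc : congruent_under P C D -> equivalent_under P C D.
  exact: congruent_equivalent_under.
have ca : equivalent_under P C D -> a.
  move=> eCD; have eYZ : equivalent_under P Y Z.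
    apply: (equivalent_under_trans sP) (congruent_equivalent_under YCP) _.
    apply: (equivalent_under_trans sP) eCD _.
    exact: congruent_equivalent_under (congruent_under_sym sP ZDP).
  have eq_count := parabolic_equiv_count sP sJ genP eYZ Y_couple Z_couple.
  split=> [|O oO]; last exact: eq_count.
  (* All block counts agree, so a matching exists; its compatibility with [s] and [t] is the
     required conjugacy. *)
  have [|w wW wP] := exists_weyl_matching sJ s2 t2 sf tg os ot.
    by move=> A B oA oB; rewrite -Ns // -Nt // eq_count.
  exists w => //; apply/permP => k; rewrite !permM.
  by have [_ ->] := wP ((w^-1)%g k); rewrite permKV.
by split; split; auto.
Qed.
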